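(* If $\mathbb{B}$ is a c.c.c. Boolean algebra, then $\mathbf{R}({}^\omega\mathbb{B}/\mathrm{Fin})\le_{\mathrm T}\mathbf{Part}^*(\mathbb{B})\mathbin{;}\mathbf{R}(\mathcal{P}(\omega)/\mathrm{fin})$.
   Context: For a Boolean algebra $\mathbb{A}$, $\mathbb{A}^+=\mathbb{A}\setminus\{\mathbb0\}$ and $\mathbf{R}(\mathbb{A})=\langle\mathbb{A},R,\mathbb{A}^+\rangle$ with $b\,R\,r$ iff $r\le b$ or $r\wedge b=\mathbb0$. ${}^\omega\mathbb{B}/\mathrm{Fin}$ is the product ${}^\omega\mathbb{B}$ modulo $\mathrm{Fin}=\{f:\{n:f(n)>\mathbb0\}\text{ finite}\}$. For c.c.c. $\mathbb{B}$, $\mathrm{Part}(\mathbb{B})$ is the set of maximal antichains of $\mathbb{B}^+$; for $A,B\in\mathrm{Part}(\mathbb{B})$, $A\le B$ if every $b\in B$ lies below some $a\in A$, $A^F=(A\setminus F)\cup\{\bigvee F\}$ for finite $F\subseteq A$, and $A\le^*B$ if $A^F\le B$ for some finite $F\subseteq A$; $\mathbf{Part}^*(\mathbb{B})=\langle\mathrm{Part}(\mathbb{B}),\le^*,\mathrm{Part}(\mathbb{B})\rangle$. A relational system is a triple $\mathbf{A}=\langle A_-,A,A_+\rangle$ with $A\subseteq A_-\times A_+$. The sequential composition of $\mathbf{A}$ and $\mathbf{B}$ is $\mathbf{A}\mathbin{;}\mathbf{B}=\langle A_-\times{}^{A_+}B_-,S,A_+\times B_+\rangle$ where $\langle\langle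 x,f\rangle,\langle a,b\rangle\rangle\in S$ iff $\langle x,a\rangle\in A$ and $\langle f(a),b\rangle\in B$ (here ${}^{A_+}B_-$ is the set of functions $A_+\to B_-$). A generalized Galois–Tukey connection from $\mathbf{A}$ to $\mathbf{B}$ is a pair $\varphi_-\colon A_-\to B_-$, $\varphi_+\colon B_+\to A_+$ with $\langle\varphi_-(a),b\rangle\in B\Rightarrow\langle a,\varphi_+(b)\rangle\in A$; $\mathbf{A}\le_{\mathrm T}\mathbf{B}$ means one exists. *)

(* Defs.v *)
From HB Require Import structures.
From mathcomp Require Import all_boot all_order finmap.
From mathcomp Require Import boolp classical_sets functions cardinality.

Set Implicit Arguments.
Unset Strict Implicit.
Unset Printing Implicit Defensive.

Import Order.Theory.

Local Open Scope classical_set_scope.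
Local Open Scope order_scope.

(* Boolean algebras are MathComp's ctbDistrLatticeType; the one-element algebra
   is an instance of that structure. *)

Section FunBoolAlg.
Variables (I : Type) (d : Order.disp_t) (T : ctbDistrLatticeType d).
Implicit Types f g h : I -> T.

Fact fun_meetUl :
  left_distributive (Order.meet : (I -> T) -> _ -> _) Order.join.
Proof. by move=> f g h; apply/funext => x; exact: meetUl. Qed.

Fact fun_joinIl :
  left_distributive (Order.join : (I -> T) -> _ -> _) Order.meet.
Proof. by move=> f g h; apply/funext => x; exact: joinIl. Qed.

HB.instance Definition _ :=
  Order.Lattice_isDistributive.Build _ (I -> T) fun_meetUl fun_joinIl.

Fact fun_le0x f : (fun=> \bot : T) <= f.
Proof. by apply/lefP => x; exact: le0x. Qed.

Fact fun_lex1 f : f <= (fun=> \top : T).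
Proof. by apply/lefP => x; exact: lex1. Qed.

HB.instance Definition _ := Order.hasBottom.Build _ (I -> T) fun_le0x.
HB.instance Definition _ := Order.hasTop.Build _ (I -> T) fun_lex1.

Fact fun_joinxC f : f `|` (fun i => ~` f i) = \top.
Proof. by apply/funext => x; exact: joinxC. Qed.

Fact fun_meetxC f : f `&` (fun i => ~` f i) = \bot.
Proof. by apply/funext => x; exact: meetxC. Qed.

HB.instance Definition _ :=
  Order.TBDistrLattice_hasComplement.Build _ (I -> T) fun_joinxC fun_meetxC.

End FunBoolAlg.

Record boolIdeal (d : Order.disp_t) (T : ctbDistrLatticeType d) := BoolIdeal {
  ideal_set :> T -> Prop;
  ideal_bot : ideal_set \bot;
  ideal_le : forall x y : T, x <= y -> ideal_set y -> ideal_set x;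
  ideal_join : forall x y : T,
    ideal_set x -> ideal_set y -> ideal_set (x `|` y)
}.

Fact quot_display : Order.disp_t. Proof. by []. Qed.

Section QuotBoolAlg.
Variables (d : Order.disp_t) (T : ctbDistrLatticeType d) (I : boolIdeal T).
Implicit Types x y z : T.

Definition ideal_eq x y : bool := `[< I ((x `\` y) `|` (y `\` x)) >].

Lemma ideal_eqP x y :
  reflect (exists2 i, I i & x `|` i = y `|` i) (ideal_eq x y).
Proof.
apply: (iffP (asboolP _)) => [Ixy|[i Ii xyi]].
  exists ((x `\` y) `|` (y `\` x)) => //.
  have le_xy u v : u <= v `|` ((u `\` v) `|` (v `\` u)) by rewrite -leBLR leUl.
  apply/eqP; rewrite eq_le; apply/andP; split; rewrite leUx leUr andbT.
    exact: le_xy.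
  by rewrite [X in _ `|` X]joinC; exact: le_xy.
apply: ideal_le Ii; rewrite leUx !leBLR.
by rewrite -{1}xyi leUl xyi leUl.
Qed.

Fact ideal_eq_refl : reflexive ideal_eq.
Proof. by move=> x; apply/ideal_eqP; exists \bot => //; exact: ideal_bot. Qed.

Fact ideal_eq_sym : symmetric ideal_eq.
Proof. by move=> x y; rewrite /ideal_eq joinC. Qed.

Fact ideal_eq_trans : transitive ideal_eq.
Proof.
move=> y x z /ideal_eqP[i Ii xy] /ideal_eqP[j Ij yz]; apply/ideal_eqP.
exists (i `|` j); first exact: ideal_join.
by rewrite joinA xy joinAC yz joinAC -joinA.
Qed.

Canonical ideal_equiv :=
  EquivRel ideal_eq ideal_eq_refl ideal_eq_sym ideal_eq_trans.

Definition quotBA := {eq_quot ideal_equiv}%qT.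

HB.instance Definition _ := Choice.on quotBA.
HB.instance Definition _ := EqQuotient.on quotBA.

Local Open Scope quotient_scope.

Lemma quotBAP x y : \pi_quotBA x = \pi_quotBA y <->
  exists2 i, I i & x `|` i = y `|` i.
Proof.
split=> [/eqquotP/ideal_eqP //|xy]; exact/eqquotP/ideal_eqP.
Qed.

Definition quot_meet (a b : quotBA) : quotBA := \pi_quotBA (repr a `&` repr b).
Definition quot_join (a b : quotBA) : quotBA := \pi_quotBA (repr a `|` repr b).
Definition quot_compl (a : quotBA) : quotBA := \pi_quotBA (~` repr a).
Definition quot_le (a b : quotBA) : bool := quot_meet a b == a.
Definition quot_lt (a b : quotBA) : bool := (b != a) && quot_le a b.

Lemma quot_repr x :
  exists2 i, I i & repr (\pi_quotBA x) `|` i = x `|` i.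
Proof. by apply/quotBAP; rewrite reprK. Qed.

Lemma pi_meet x y : quot_meet (\pi_quotBA x) (\pi_quotBA y) = \pi_quotBA (x `&` y).
Proof.
have [i Ii xi] := quot_repr x; have [j Ij yj] := quot_repr y.
apply/quotBAP; exists (i `|` j); first exact: ideal_join.
by rewrite !joinIl !joinA xi ![_ `|` i `|` j]joinAC yj.
Qed.

Lemma pi_join x y : quot_join (\pi_quotBA x) (\pi_quotBA y) = \pi_quotBA (x `|` y).
Proof.
have [i Ii xi] := quot_repr x; have [j Ij yj] := quot_repr y.
apply/quotBAP; exists (i `|` j); first exact: ideal_join.
by rewrite joinACA xi yj joinACA.
Qed.

Lemma pi_compl x : quot_compl (\pi_quotBA x) = \pi_quotBA (~` x).
Proof.
have [i Ii xi] := quot_repr x; apply/quotBAP; exists i => //.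
have E z : ~` z `|` i = ~` (z `|` i) `|` i.
  by rewrite complU joinIl [X in _ `&` X]joinC joinxC meetx1.
by rewrite E xi -E.
Qed.

Fact quot_meetC : commutative quot_meet.
Proof. by move=> a b; rewrite /quot_meet meetC. Qed.

Fact quot_joinC : commutative quot_join.
Proof. by move=> a b; rewrite /quot_join joinC. Qed.

Fact quot_meetA : associative quot_meet.
Proof.
elim/quotW=> x; elim/quotW=> y; elim/quotW=> z.
by rewrite (pi_meet y z) (pi_meet x y) !pi_meet meetA.
Qed.

Fact quot_joinA : associative quot_join.
Proof.
elim/quotW=> x; elim/quotW=> y; elim/quotW=> z.
by rewrite (pi_join y z) (pi_join x y) !pi_join joinA.
Qed.

Fact quot_joinKI (b a : quotBA) : quot_meet a (quot_join a b) = a.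
Proof.
by elim/quotW: a => x; elim/quotW: b => y; rewrite (pi_join x y) pi_meet joinKI.
Qed.

Fact quot_meetKU (b a : quotBA) : quot_join a (quot_meet a b) = a.
Proof.
by elim/quotW: a => x; elim/quotW: b => y; rewrite (pi_meet x y) pi_join meetKU.
Qed.

Fact quot_meetUl : left_distributive quot_meet quot_join.
Proof.
elim/quotW=> x; elim/quotW=> y; elim/quotW=> z.
by rewrite (pi_join x y) (pi_meet x z) (pi_meet y z) pi_meet pi_join meetUl.
Qed.

Fact quot_meetxx : idempotent_op quot_meet.
Proof. by elim/quotW=> x; rewrite pi_meet meetxx. Qed.

HB.instance Definition _ := Order.isMeetJoinDistrLattice.Build
  quot_display quotBA (fun _ _ => erefl) (fun _ _ => erefl)
  quot_meetC quot_joinC quot_meetA quot_joinA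
  quot_joinKI quot_meetKU quot_meetUl quot_meetxx.

Fact quot_le0x (a : quotBA) : (\pi_quotBA \bot : quotBA) <= a.
Proof. by elim/quotW: a => x; rewrite leEmeet /Order.meet /= pi_meet meet0x. Qed.

Fact quot_lex1 (a : quotBA) : a <= (\pi_quotBA \top : quotBA).
Proof. by elim/quotW: a => x; rewrite leEmeet /Order.meet /= pi_meet meetx1. Qed.

HB.instance Definition _ := Order.hasBottom.Build quot_display quotBA quot_le0x.
HB.instance Definition _ := Order.hasTop.Build quot_display quotBA quot_lex1.

Fact quot_joinxC (a : quotBA) : a `|` quot_compl a = \top.
Proof. by elim/quotW: a => x; rewrite pi_compl /Order.join /= pi_join joinxC. Qed.

Fact quot_meetxC (a : quotBA) : a `&` quot_compl a = \bot.
Proof. by elim/quotW: a => x; rewrite pi_compl /Order.meet /= pi_meet meetxC. Qed.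

HB.instance Definition _ := Order.TBDistrLattice_hasComplement.Build
  quot_display quotBA quot_joinxC quot_meetxC.

End QuotBoolAlg.

Section FinIdeals.
Variables (d : Order.disp_t) (B : ctbDistrLatticeType d).

Definition Fin_set : set (nat -> B) :=
  [set f | finite_set [set n | \bot < f n]].

Fact Fin_bot : Fin_set \bot.
Proof.
apply: (sub_finite_set _ (finite_set0 nat)) => n /=.
by rewrite [X in _ < X](_ : _ = \bot) // ltxx.
Qed.

Fact Fin_le (f g : nat -> B) : f <= g -> Fin_set g -> Fin_set f.
Proof.
by move=> /lefP fg; apply: sub_finite_set => n /= /lt_le_trans; exact.
Qed.

Fact Fin_join (f g : nat -> B) : Fin_set f -> Fin_set g -> Fin_set (f `|` g).
Proof.
move=> Ff Fg; apply: (@sub_finite_set _ _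
  ([set n | \bot < f n] `|` [set n | \bot < g n])%classic); last first.
  by rewrite finite_setU.
move=> n /=; rewrite !lt0x => fg0.
have [f0|f0] := eqVneq (f n) \bot; last by left.
have [g0|g0] := eqVneq (g n) \bot; last by right.
by case/eqP: fg0; rewrite /Order.join /= /FunOrder.joinf f0 g0 joinxx.
Qed.

Definition Fin : boolIdeal (nat -> B) := BoolIdeal Fin_bot Fin_le Fin_join.

End FinIdeals.

Fact fin_le (X Y : set nat) : X <= Y -> finite_set Y -> finite_set X.
Proof. by move=> /subsetPset; exact: sub_finite_set. Qed.

Fact fin_join (X Y : set nat) :
  finite_set X -> finite_set Y -> finite_set (X `|` Y)%O.
Proof. by move=> fX fY; rewrite joinEset finite_setU. Qed.

Definition fin : boolIdeal (set nat) :=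
  BoolIdeal (finite_set0 nat) fin_le fin_join.

Definition powBA_mod_Fin (d : Order.disp_t) (B : ctbDistrLatticeType d) :=
  quotBA (Fin B).

Definition Pomega_mod_fin := quotBA fin.

HB.instance Definition _ (d : Order.disp_t) (B : ctbDistrLatticeType d) :=
  Order.CTBDistrLattice.on (powBA_mod_Fin B).
HB.instance Definition _ := Order.CTBDistrLattice.on Pomega_mod_fin.

Record relSystem := RelSystem {
  rs_minus : Type;
  rs_plus : Type;
  rs_rel : rs_minus -> rs_plus -> Prop
}.

Definition seq_comp (A B : relSystem) : relSystem :=
  @RelSystem (rs_minus A * (rs_plus A -> rs_minus B)) (rs_plus A * rs_plus B)
    (fun xf ab => rs_rel xf.1 ab.1 /\ rs_rel (xf.2 ab.1) ab.2).

Definition galois_tukey (A B : relSystem)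
    (phim : rs_minus A -> rs_minus B) (phip : rs_plus B -> rs_plus A) : Prop :=
  forall (a : rs_minus A) (b : rs_plus B),
    rs_rel (phim a) b -> rs_rel a (phip b).

Definition tukey_le (A B : relSystem) : Prop :=
  exists phim phip, @galois_tukey A B phim phip.

Section BoolAlgSystems.
Variables (d : Order.disp_t) (B : ctbDistrLatticeType d).

Definition Rsys : relSystem :=
  @RelSystem B {r : B | r != \bot}
    (fun b r => sval r <= b \/ sval r `&` b = \bot).

Definition antichain (A : set B) : Prop :=
  (forall a, A a -> a != \bot) /\
  (forall a b, A a -> A b -> a != b -> a `&` b = \bot).

Definition ccc : Prop := forall A : set B, antichain A -> countable A.

Definition maximal_antichain (A : set B) : Prop :=
  antichain A /\
  forall A' : set B, antichain A' -> (A `<=` A')%classic -> A' = A.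

Definition Part : Type := {A : set B | maximal_antichain A}.

Definition refined_by (A A' : set B) : Prop :=
  forall b, A' b -> exists2 a, A a & b <= a.

(* For empty F this adds \bot to A, which is harmless: no element of a partition
   lies below \bot. *)
Definition coarsen (A : set B) (F : {fset B}) : set B :=
  ((A `\` [set` F]) `|` [set \join_(x <- F) x])%classic.

Definition le_star (A A' : Part) : Prop :=
  exists2 F : {fset B}, ([set` F] `<=` sval A)%classic &
    refined_by (coarsen (sval A) F) (sval A').

Definition PartStar : relSystem := @RelSystem Part Part le_star.

End BoolAlgSystems.

(* Main.v *)
Require Import Defs.
From mathcomp Require Import all_boot all_order.
From mathcomp Require Import finmap boolp classical_sets functions cardinality.

Set Implicit Arguments.
Unset Strict Implicit.
Unset Printing Implicit Defensive.

Import Order.Theory.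

Local Open Scope classical_set_scope.
Local Open Scope order_scope.

(* If [B] has an atom [u], then [u] decides every [b], and the sequence equal to
   [u] on [r] and to [\bot] elsewhere reaps [f] as soon as [r] reaps
   [{n | u <= f n}].  Otherwise [B] has an infinite antichain [(t n)], fixed once
   and for all.  Send [f] to a maximal antichain extending the nonzero elements
   among [t n `&` f n] and [t n `\` f n].  If [P] almost refines it, then for
   all but finitely many [n] the exceptional finite set does not meet [t n], so
   that any element of [P] meeting [t n] lies below [f n] or is disjoint from it.
   Choosing one such element [h P n] for each [n] reduces the reaping of [f] to
   that of [{n | h P n <= f n}]. *)

Section QuotientOrder.
Variables (d : Order.disp_t) (T : ctbDistrLatticeType d) (I : boolIdeal T).
Implicit Types x y : T.
Local Open Scope quotient_scope.

Lemma quotBA_eq_bot x : \pi_(quotBA I) x = \bot <-> I x.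
Proof.
split=> [/quotBAP[i Ii xi]|Ix]; last first.
  by apply/quotBAP; exists x; rewrite ?joinxx ?join0x.
by apply: ideal_le Ii; rewrite -[i]join0x -xi leUl.
Qed.

Lemma quotBA_meet x y :
  \pi_(quotBA I) x `&` \pi_(quotBA I) y = \pi_(quotBA I) (x `&` y).
Proof. exact: pi_meet. Qed.

Lemma quotBA_compl x : ~` \pi_(quotBA I) x = \pi_(quotBA I) (~` x).
Proof. exact: pi_compl. Qed.

Lemma quotBA_le x y : \pi_(quotBA I) x <= \pi_(quotBA I) y <-> I (x `\` y).
Proof.
rewrite -quotBA_eq_bot diffE -quotBA_meet -quotBA_compl -diffE.
by rewrite -diff_eq0; split=> /eqP.
Qed.

End QuotientOrder.

Section Antichains.
Variables (d : Order.disp_t) (B : ctbDistrLatticeType d).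
Implicit Types (A X : set B) (P : Part B).

(** Zorn's lemma is applied to the sets that can be added to [X], not to the antichains containing
    [X], so that the empty chain needs no separate treatment. *)
Lemma antichain_extend X : antichain X ->
  exists2 A, maximal_antichain A & X `<=` A.
Proof.
move=> [X0 Xd].
have [|A [[XA0 XAd] Amax]] := @Zorn_bigcup B [set Y | antichain (X `|` Y)].
  move=> F FP Ftot; split=> [a [|[Y FY Ya]]|a b].
  - exact: X0.
  - by apply: (FP Y FY).1; right.
  case=> [Xa|[Y FY Ya]] [Xb|[Z FZ Zb]].
  - exact: Xd.
  - by apply: (FP Z FZ).2; [left|right].
  - by apply: (FP Y FY).2; [right|left].
  - have [YZ|ZY] := Ftot Y Z FY FZ.
      by apply: (FP Z FZ).2; right=> //; exact: YZ.
    by apply: (FP Y FY).2; right=> //; exact: ZY.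
exists (X `|` A); last by move=> x; left.
split=> // A' acA' XAA'; apply/seteqP; split=> // x A'x.
apply: contrapT => XAx; apply: (Amax A').
  split=> [y Ay|A'A]; first by apply: XAA'; right.
  by apply: XAx; right; exact: A'A.
rewrite /= setUidr// => y Xy; by apply: XAA'; left.
Qed.

(** Otherwise adding [x] to [A] leaves an antichain, so [x] lies in [A] by maximality and meets
    itself. *)
Lemma maximal_antichain_meets A x : maximal_antichain A -> x != \bot ->
  exists2 a, A a & a `&` x != \bot.
Proof.
move=> [[A0 Ad] Amax] x0; apply: contrapT => nA.
have Ax a : A a -> a `&` x = \bot.
  by move=> Aa; apply/eqP/negPn/negP => ax; apply: nA; exists a.
have : A x.
  suff <- : A `|` [set x] = A by right.
  apply: Amax => [|y]; last by left.
  split=> [a [/A0//|->//]|a b [Aa|->] [Ab|->]].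
  - exact: Ad.
  - by rewrite Ax.
  - by rewrite meetC Ax.
  - by rewrite eqxx.
by move=> /Ax; rewrite meetxx; apply/eqP.
Qed.

(** The relation of [Rsys B] with its arguments swapped, on all of [B]. *)
Definition decides (x y : B) := x <= y \/ x `&` y = \bot.

Definition is_atom (u : B) := u != \bot /\ forall x, decides u x.

(** Without atoms a strictly decreasing sequence of nonzero elements descends from [\top]; the
    differences of its successive terms are nonzero and pairwise disjoint. *)
Lemma atomless_antichain : \bot <> \top :> B -> ~ (exists u, is_atom u) ->
  exists t : nat -> B, (forall n, t n != \bot) /\
    (forall m n, m != n -> t m `&` t n = \bot).
Proof.
move=> nt noatom.
have split_ (s : {x : B | x != \bot}) : exists s' : {x : B | x != \bot},
    sval s' <= sval s /\ sval s `\` sval s' != \bot.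
  case: s => s s0 /=; apply: contrapT => ns; apply: noatom; exists s.
  split=> // x; have [sx|sx] := eqVneq (s `&` x) \bot; [by right|left].
  (* When [s] does not decide [x], both pieces into which [x] cuts [s] are nonzero. *)
  apply: contrapT => nsx; apply: ns; exists (exist _ (s `&` x) sx) => /=.
  split; first exact: leIl.
  by rewrite diffxI diffxx join0x diff_eq0; exact/negP.
have [nxt nxtP] := choice split_.
have top0 : (\top : B) != \bot by apply/eqP => E; exact: nt.
pose s n := iter n nxt (exist _ \top top0).
have s_le m n : (m <= n)%N -> sval (s n) <= sval (s m).
  move=> /subnK <-; elim: (n - m)%N => // k IH.
  by rewrite addSn; apply: le_trans (nxtP _).1 IH.
exists (fun n => sval (s n) `\` sval (s n.+1)); split=> [n|].
  exact: (nxtP (s n)).2.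
have lt_case m n : (m < n)%N ->
    (sval (s m) `\` sval (s m.+1)) `&` (sval (s n) `\` sval (s n.+1)) = \bot.
  move=> mn; apply/eqP; rewrite -lex0.
  apply: le_trans (leI2 (lexx _) (le_trans (leBx _ _) (s_le _ _ mn))) _.
  by rewrite diffIK.
move=> m n; case: ltngtP => // mn _; first exact: lt_case.
by rewrite meetC; exact: lt_case.
Qed.

(** An element of [A] that meets [t n] is one of the two halves of [t n] cut by [f n], so it meets
    no other [t m]. Hence the finite set [F] merged in [le_star] meets only finitely many [t n]. *)
Lemma le_star_decides (t f : nat -> B) (A P : Part B) (p : nat -> B) :
    (forall m n, m != n -> t m `&` t n = \bot) ->
    [set x | x != \bot /\ exists n, x = t n `&` f n \/ x = t n `\` f n]
      `<=` sval A ->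
    (forall n, sval P (p n) /\ p n `&` t n != \bot) ->
  le_star A P -> finite_set [set n | ~ decides (p n) (f n)].
Proof.
move=> tD XA pP [F FA FP].
have memX n a : sval A a -> a `&` t n != \bot ->
    a = t n `&` f n \/ a = t n `\` f n.
  move=> Aa /eqP at0; apply: contrapT => /not_orP[nI nD]; apply: at0.
  have dis x : x = t n `&` f n \/ x = t n `\` f n -> a `&` x = \bot.
    move=> xE; have [->|x0] := eqVneq x \bot; first by rewrite meetx0.
    apply: (proj2 (proj1 (svalP A))) => //; first by apply: XA; split=> //; exists n.
    by apply/eqP => ax; case: xE; rewrite -ax.
  have tE : t n = (t n `&` f n) `|` (t n `\` f n) by rewrite joinIB.
  by rewrite tE meetUr !dis ?joinxx//; [right|left].
have key n : ~ decides (p n) (f n) ->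
    exists2 a, a \in F & a `&` t n != \bot.
  move=> nd; apply: contrapT => nF; apply: nd.
  have [Pp pt] := pP n; have [a Ca pa] := FP _ Pp.
  have at0 : a `&` t n != \bot.
    by apply: contraNneq pt => at0; rewrite -lex0 -at0 leI2.
  case: Ca => [[Aa _]|/= aE].
    have [aE|aE] := memX _ _ Aa at0.
      by left; apply: le_trans pa _; rewrite aE leIr.
    right; apply/eqP; rewrite -lex0; apply: le_trans (leI2 pa (lexx _)) _.
    by rewrite aE diffIK.
  (* If no element of [F] meets [t n], neither does their join; for empty [F] the join is [\bot]. *)
  case/eqP: at0; rewrite aE big_seq.
  elim/big_rec: _ => [|x y xF IH]; first by rewrite meet0x.
  rewrite meetUl IH joinx0; apply/eqP/negPn/negP => xt.
  by apply: nF; exists x.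
apply: (@sub_finite_set _ _ (\bigcup_(a in [set` F]) [set n | a `&` t n != \bot])).
  by move=> n /key[a aF at0]; exists a.
apply: bigcup_finite => [|a /FA Aa]; first exact: finite_fset.
have [[m /= am]|nm] := pselect (exists m, a `&` t m != \bot); last first.
  by apply: (sub_finite_set _ (finite_set0 nat)) => n an; apply: nm; exists n.
apply: (sub_finite_set _ (finite_set1 m)) => n /= an.
have a_le : a <= t m by have [->|->] := memX _ _ Aa am; [exact: leIl|exact: leBx].
apply/eqP; apply: contraNT an => nm; rewrite -lex0 -(tD m n) 1?eq_sym //.
exact: leI2.
Qed.

End Antichains.

Section TukeyReduction.
Variables (d : Order.disp_t) (B : ctbDistrLatticeType d).
Local Open Scope quotient_scope.

Definition restrict_seq (X : set nat) (h : nat -> B) : nat -> B :=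
  fun n => if `[< X n >] then h n else \bot.

Lemma fun_meetE (f g : nat -> B) n : (f `&` g) n = f n `&` g n.
Proof. by []. Qed.

Lemma fun_diffE (f g : nat -> B) n : (f `\` g) n = f n `\` g n.
Proof. by rewrite [f `\` g]diffE [RHS]diffE. Qed.

(** Ensures that the second map of the connection takes nonzero values. *)
Lemma restrict_seq_Fin (X : set nat) (h : nat -> B) :
  (forall n, h n != \bot) -> Fin B (restrict_seq X h) -> finite_set X.
Proof.
move=> h0; apply: sub_finite_set => n Xn /=.
by rewrite /restrict_seq asboolT // lt0x.
Qed.

(** Serves both with and without atoms. The sequence [h P] must not depend on [f], because the
    second map of the connection sees [P] but not [f]. *)
Lemma tukey_le_of_decides (h : Part B -> nat -> B) :
    (forall P n, h P n != \bot) ->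
    (forall f : nat -> B, exists A : Part B, forall P, le_star A P ->
      finite_set [set n | ~ decides (h P n) (f n)]) ->
  tukey_le (Rsys (powBA_mod_Fin B))
           (seq_comp (PartStar B) (Rsys Pomega_mod_fin)).
Proof.
move=> h0 /choice[A AP].
have pos (P : Part B) (r : {r : Pomega_mod_fin | r != \bot}) :
    (\pi_(quotBA (Fin B)) (restrict_seq (repr (sval r)) (h P))
      : powBA_mod_Fin B) != \bot.
  case: r => r /= r0; apply: contraNneq r0.
  move=> /quotBA_eq_bot/restrict_seq_Fin-/(_ (h0 P)) fX.
  by apply/eqP; rewrite -[r]reprK; apply/quotBA_eq_bot.
exists (fun b : powBA_mod_Fin B => (A (repr b),
  fun P => \pi_(quotBA fin) [set n | h P n <= repr b n] : Pomega_mod_fin)).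
exists (fun Pr : Part B * {r : Pomega_mod_fin | r != \bot} =>
  exist (fun x : powBA_mod_Fin B => is_true (x != \bot)) _ (pos Pr.1 Pr.2)) => b [P [r r0]] /= [/AP dec rG].
set f := repr b in dec rG *; set X := repr r.
rewrite -[b]reprK -/f; case: rG => [|]; rewrite -{1}[r]reprK -/X.
  move=> /quotBA_le fin_XG; left; apply/quotBA_le.
  apply: sub_finite_set fin_XG => n /=.
  rewrite fun_diffE lt0x diff_eq0 /restrict_seq; case: asboolP => [Xn /negP nle|_]; last first.
    by rewrite le0x.
  by rewrite subEset.
rewrite quotBA_meet => /quotBA_eq_bot fin_XG; right.
rewrite quotBA_meet; apply/quotBA_eq_bot.
(* For [n] in [X], [h P n] meets [f n] only if it lies below [f n] or does not decide it; each
   happens finitely often. *)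
have : finite_set ((X `&` [set n | h P n <= f n])%classic
    `|` [set n | ~ decides (h P n) (f n)])%classic by rewrite finite_setU.
apply: sub_finite_set => n /=.
rewrite fun_meetE lt0x /restrict_seq.
case: asboolP => [Xn /eqP nz|_]; last by rewrite meet0x eqxx.
have [le_hf|nle] := pselect (h P n <= f n); [by left|right].
by case.
Qed.

End TukeyReduction.

Theorem theorem4p4 (d : Order.disp_t) (B : ctbDistrLatticeType d)
    (B_nontrivial : (\bot : B)%O <> (\top : B)%O) (B_ccc : ccc B) :
  tukey_le (Rsys (powBA_mod_Fin B))
           (seq_comp (PartStar B) (Rsys Pomega_mod_fin)).
Proof.
have [[u [u0 ud]]|/atomless_antichain] := pselect (exists u : B, is_atom u).
  apply: (@tukey_le_of_decides _ _ (fun _ _ => u)) => // f.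
  (* As [u] decides every element, any maximal antichain serves. *)
  have [|A Amax _] := @antichain_extend _ B set0; first by split.
  exists (exist _ A Amax) => P _.
  by apply: (sub_finite_set _ (finite_set0 nat)) => n; apply; exact: ud.
move=> /(_ B_nontrivial)[t [t0 tD]].
have meets (P : Part B) n : exists p, sval P p /\ p `&` t n != \bot.
  by have [p] := maximal_antichain_meets (svalP P) (t0 n); exists p.
pose h P n := sval (cid (meets P n)).
have hP P n : sval P (h P n) /\ h P n `&` t n != \bot := svalP (cid (meets P n)).
apply: (@tukey_le_of_decides _ _ h) => [P n|f].
  by apply: (proj1 (proj1 (svalP P))); exact: (hP P n).1.
have [|A Amax XA] := @antichain_extend _ B
  [set x | x != \bot /\ exists n, x = t n `&` f n \/ x = t n `\` f n].
  split=> [x []//|x y [x0 [m xm]] [y0 [n yn]] xy].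
  have xt : x <= t m by case: xm => ->; [exact: leIl|exact: leBx].
  have yt : y <= t n by case: yn => ->; [exact: leIl|exact: leBx].
  (* Pieces of different [t m] and [t n] are disjoint; distinct pieces of the same one are its two
     complementary halves. *)
  have [mn|mn] := eqVneq m n; last first.
    by apply/eqP; rewrite -lex0 -(tD m n mn) leI2.
  subst n; case: xm yn xy => -> [] ->; rewrite ?eqxx// => _.
    by rewrite -meetA diffKI meetx0.
  by rewrite [t m `&` f m]meetC meetA diffIK meet0x.
exists (exist _ A Amax) => P.
exact: (@le_star_decides _ _ t f (exist _ A Amax) P _ tD XA (hP P)).
Qed.
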